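(* Let $G$ be a finite group and $H$ a proper subgroup of $G$. Then $\alpha(\rho^a_{[G;H]})>1$ if and only if the index $|G:H|$ is a prime power. In the latter case, $p$ divides $\alpha(\rho^a_{[G;H]})$, where $p$ is the unique prime divisor of $|G:H|$.
   Context: All representations are finite-dimensional complex unitary representations. For a representation $\rho:G\to GL(V)$ of a finite group $G$, let $S(V)$ be the unit sphere of $V$ and $G(x)$ the $G$-orbit of $x$. The $\alpha$-characteristic of $\rho$ is $\alpha(\rho):=\gcd\{|G(x)| : x\in S(V)\}$. For $H<G$, the complex permutation representation of $G$ on $G/H$ (left translation) is equivalent to $\mathbf 1_G\oplus\rho$, where $\mathbf 1_G$ is the trivial representation and $\rho$ has no trivial constituents; $\rho$ is the augmentation representation, denoted $\rho^a_{[G;H]}$. *)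

(* Defs.v *)
From HB Require Import structures.
From mathcomp Require Import all_boot all_order all_algebra all_fingroup.
From mathcomp Require Import spectral mxrepresentation character.
From mathcomp Require Import finmap.
From mathcomp Require Import boolp reals complex.

Set Implicit Arguments.
Unset Strict Implicit.
Unset Printing Implicit Defensive.

Import Order.TTheory GRing.Theory Num.Theory.

Local Open Scope ring_scope.

(* The field of complex numbers is R[i] for R : realType. A representation rho *)
(* of G acts on column vectors: g sends x to rho g *m x, which is a left       *)
(* action since rho (g * h) = rho g *m rho h. The Hermitian structure is the   *)
(* standard one on R[i]^n.                                                     *)

Section AlphaCharacteristic.

Variables (R : realType) (gT : finGroupType) (G : {group gT}).
Implicit Type rho : representation R[i] G.

Definition unitary_repr rho : Prop :=
  forall g, g \in G -> rho g \is unitarymx.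

Definition unit_sphere n (x : 'cV[R[i]]_n) : Prop :=
  \sum_i `|x i 0| ^+ 2 = 1.

Definition repr_orbit rho (x : 'cV[R[i]]_(rdegree rho)) :
    {fset 'cV[R[i]]_(rdegree rho)} :=
  [fset rho g *m x | g in G]%fset.

Definition orbit_length rho (k : nat) : Prop :=
  exists x : 'cV[R[i]]_(rdegree rho), unit_sphere x /\ k = #|` repr_orbit x|%N.

Lemma repr_orbit_le rho (x : 'cV[R[i]]_(rdegree rho)) :
  (#|` repr_orbit x| <= #|G|)%N.
Proof.
apply: leq_trans (leq_imfset_card _ _ _) _; rewrite cardE.
apply: uniq_leq_size; first exact: enum_finmem_uniq.
by move=> g; rewrite enum_finmemE.
Qed.

(* The range k <= #|G| loses nothing by repr_orbit_le: alpha_char is the gcd   *)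
(* of all orbit lengths on the unit sphere, see dvdn_alpha_char.               *)
Definition alpha_char rho : nat :=
  \big[gcdn/0%N]_(k < #|G|.+1 | `[< orbit_length rho k >]) (k : nat).

Lemma dvdn_alpha_char rho (d : nat) :
  (d %| alpha_char rho)%N <->
  forall x : 'cV[R[i]]_(rdegree rho),
    unit_sphere x -> (d %| #|` repr_orbit x|)%N.
Proof.
split=> [/dvdn_biggcdP dG x Sx | dS].
  have lt_k : (#|` repr_orbit x| < #|G|.+1)%N by rewrite ltnS repr_orbit_le.
  by apply: (dG (Ordinal lt_k)); apply/asboolP; exists x.
by apply/dvdn_biggcdP => k /asboolP[x [Sx ->]]; apply: dS.
Qed.

End AlphaCharacteristic.

Section Augmentation.

Variables (F : fieldType) (gT : finGroupType) (G : {group gT}).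

Lemma triv_mx_repr : mx_repr G (fun _ : gT => 1%:M : 'M[F]_1).
Proof. by split=> // g h _ _; rewrite mulmx1. Qed.

Definition triv_repr : representation F G :=
  Representation (MxRepresentation triv_mx_repr).

Definition constituent (tau rho : representation F G) : Prop :=
  exists sigma : representation F G, mx_rsim rho (dadd_grepr tau sigma).

Variable H : {group gT}.

(* Column j is the basis vector of the coset g *: (enum_val j).                *)
Definition coset_perm_mx (g : gT) : 'M[F]_#|lcosets H G| :=
  \matrix_(i, j) (enum_val i == (g *: enum_val j)%g)%:R.

Lemma coset_perm_mx_repr : mx_repr G coset_perm_mx.
Proof.
split=> [|g h Gg Gh]; apply/matrixP=> i j; rewrite !mxE.
  by rewrite lcoset1 (inj_eq enum_val_inj).
have Hj : (h *: enum_val j)%g \in lcosets H G.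
  have /lcosetsP[x Gx ->] := enum_valP j.
  by rewrite -lcosetM; apply/lcosetsP; exists (h * x)%g; rewrite ?groupM.
rewrite (bigD1 (enum_rank_in Hj (h *: enum_val j)%g)) //= big1 ?addr0 => [|k nk].
  by rewrite !mxE enum_rankK_in // eqxx mulr1 lcosetM.
rewrite !mxE; case: (enum_val k =P _) => [Ek|_]; last by rewrite mulr0.
by case/eqP: nk; apply: enum_val_inj; rewrite enum_rankK_in.
Qed.

Definition coset_perm_repr : representation F G :=
  Representation (MxRepresentation coset_perm_mx_repr).

(* The augmentation representation is only determined up to equivalence; this  *)
(* says that rho is one of its representatives.                                *)
Definition is_augmentation (rho : representation F G) : Prop :=
  mx_rsim coset_perm_repr (dadd_grepr triv_repr rho) /\
  ~ constituent triv_repr rho.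

End Augmentation.

Definition prime_power (n : nat) : Prop :=
  exists p k, [/\ prime p, (0 < k)%N & n = (p ^ k)%N].

(* Main.v *)
(* For K <= G, rho has a nonzero K-fixed vector iff K is not transitive on     *)
(* G / H, i.e. iff K H <> G: the indicator of a K-orbit is constant only if    *)
(* the orbit is everything, and constants span the trivial summand. If |G : H| *)
(* is a power of p and p does not divide |G : G_x|, the two indices are        *)
(* coprime, so G_x H = G and x = 0. If p divides all orbit lengths, a Sylow    *)
(* p-subgroup P fixes no unit vector, since |G : P| is prime to p; hence       *)
(* P H = G and |G : H| = |P : P :&: H| is a power of p.                        *)

Require Import Defs.
From mathcomp Require Import all_boot all_order all_algebra all_fingroup.
From mathcomp Require Import mxrepresentation character.
From mathcomp Require Import reals complex.
From mathcomp Require Import finmap pgroup sylow.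

Set Implicit Arguments.
Unset Strict Implicit.
Unset Printing Implicit Defensive.

Import Order.TTheory GRing.Theory Num.Theory.

Local Open Scope ring_scope.

(** Everything reduces to one equivalence, [prime_dvd_alpha_augmentation]: a prime p divides every
    orbit length iff |G : H| is a power of p. It rests on two facts: orbit lengths are indices of
    stabilizers ([card_repr_orbit]), and for K <= G a nonzero K-fixed vector exists in rho exactly
    when K H <> G ([augmentation_fixed_eq0], [augmentation_fixed_neq0]). As H is proper, alpha is
    positive and |G : H| > 1, so alpha > 1 means that some prime divides alpha, and this prime is
    then the one dividing |G : H|. *)

Section CosetPermutation.

Variables (F : fieldType) (gT : finGroupType) (G H : {group gT}).

Lemma coset_perm_mxE (g : gT) (f : 'cV[F]_#|lcosets H G|) i j :
  enum_val i = (g *: enum_val j)%g -> (coset_perm_mx F G H g *m f) i 0 = f j 0.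
Proof.
move=> Ei; rewrite mxE (bigD1 j) //= mxE Ei eqxx mul1r big1 ?addr0 // => k nkj.
rewrite mxE Ei (can_eq (lcosetK g)) (inj_eq enum_val_inj) eq_sym.
by rewrite (negPf nkj) mul0r.
Qed.

Lemma mem_lcosets_group : (H : {set gT}) \in lcosets H G.
Proof. by apply/lcosetsP; exists 1%g; rewrite ?group1 // lcoset1. Qed.

Definition coset0 : 'I_#|lcosets H G| :=
  enum_rank_in mem_lcosets_group (H : {set gT}).

Lemma coset0E : enum_val coset0 = H.
Proof. by rewrite enum_rankK_in // mem_lcosets_group. Qed.

(** With g = k h, the coset g H is k H, the translate of the base coset by k, so invariance under k
    moves every value of f to the base coset. *)
Lemma transitive_fixed_const (K : {group gT}) (f : 'cV[F]_#|lcosets H G|) :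
  (K * H)%g = G -> {in K, forall k, coset_perm_mx F G H k *m f = f} ->
  f = const_mx (f coset0 0).
Proof.
move=> KH fixf; apply/colP=> i; rewrite mxE.
have /lcosetsP[g Gg Ei] := enum_valP i.
have /mulsgP[k h Kk Hh Eg] : g \in (K * H)%g by rewrite KH.
rewrite -{1}(fixf k Kk); apply: coset_perm_mxE.
by rewrite Ei Eg coset0E lcosetM lcoset_id.
Qed.

Lemma intransitive_fixed_nonconst (K : {group gT}) :
  K \subset G -> H \subset G -> (K * H)%g != G ->
  exists f : 'cV[F]_#|lcosets H G|,
    {in K, forall k, coset_perm_mx F G H k *m f = f} /\
    forall c, f != const_mx c.
Proof.
move=> sKG sHG neKH.
(* The indicator of the K-orbit of the base coset: K H is a union of left cosets of H, stable under
   left translation by K. *)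
exists (\col_(j < #|lcosets H G|) (enum_val j \subset (K * H)%g)%:R).
split=> [k Kk | c].
  apply/colP=> i.
  have Gk := subsetP sKG k Kk.
  have Hi : (k^-1 *: enum_val i)%g \in lcosets H G.
    have /lcosetsP[g Gg ->] := enum_valP i.
    by apply/lcosetsP; exists (k^-1 * g)%g; rewrite ?groupM ?groupV ?lcosetM.
  pose j := enum_rank_in Hi (k^-1 *: enum_val i)%g.
  have Ei : enum_val i = (k *: enum_val j)%g by rewrite enum_rankK_in // lcosetKV.
  rewrite (coset_perm_mxE _ Ei) !mxE enum_rankK_in // -sub_lcoset.
  congr (_ \subset _)%:R.
  by rewrite mulgA lcoset_id.
have /subsetPn[g Gg nKHg] : ~~ (G \subset (K * H)%g).
  by apply: contra neKH => sG; rewrite eqEsubset sG mul_subG.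
have Hg : (g *: H)%g \in lcosets H G by apply/lcosetsP; exists g.
(* Were the indicator constant, its value 1 at H would also be its value at g H, putting g in K
   H. *)
apply: contraNneq nKHg => /colP Ef.
have: (H : {set gT}) \subset (K * H)%g by rewrite mulG_subr.
have := Ef (enum_rank_in Hg (g *: H)%g); have := Ef coset0.
rewrite !mxE coset0E enum_rankK_in // => <- /eqP + sHKH; rewrite sHKH.
have [sgH _|_] := boolP (_ \subset _); last by rewrite eq_sym oner_eq0.
exact: (subsetP sgH) (lcoset_refl H g).
Qed.

End CosetPermutation.

Section AugmentationFixedVectors.

Variables (F : fieldType) (gT : finGroupType) (G H K : {group gT}).
Variable rho : representation F G.
Hypothesis aug : is_augmentation H rho.
Hypotheses (sHG : H \subset G) (sKG : K \subset G).

Lemma dadd_trivE g (a : 'cV[F]_1) (x : 'cV[F]_(rdegree rho)) :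
  dadd_grepr (triv_repr F G) rho g *m col_mx a x = col_mx a (rho g *m x).
Proof. by rewrite mul_block_col !mul0mx addr0 add0r mul1mx. Qed.

Lemma augmentation_mx : exists B C,
  [/\ B *m C = 1%:M, C *m B = 1%:M :> 'M[F]_(1 + rdegree rho)
    & {in G, forall g (a : 'cV_1) (x : 'cV_(rdegree rho)),
        coset_perm_mx F G H g *m (B *m col_mx a x) =
        B *m col_mx a (rho g *m x)}].
Proof.
case: aug => [[B eqn freeB homB] _].
(* The two degrees agree only propositionally, so B is not square by type: its left and right
   inverses come from its rank separately and are then identified. *)
have [C CB] : exists C, C *m B = 1%:M 
  by apply/row_fullP/eqP; rewrite (eqP freeB).
have [D BD] := row_freeP freeB.
exists B, C; split=> [|//|g Gg a x].
  by have -> : C = D by rewrite -[C]mulmx1 -BD mulmxA CB mul1mx.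
by rewrite mulmxA (homB g Gg) -mulmxA dadd_trivE.
Qed.

(** The intertwiner B sends both (0, x) and (1, 0) to K-fixed, hence constant, vectors c and d.
    Constants form a line, so d (0, x) = c (1, 0) and d x = 0, while d = 0 would kill (1, 0). *)
Lemma augmentation_fixed_eq0 (x : 'cV[F]_(rdegree rho)) :
  (K * H)%g = G -> {in K, forall k, rho k *m x = x} -> x = 0.
Proof.
move=> KH fixx; have [B [C [_ CB homB]]] := augmentation_mx.
have constB (a : 'cV_1) (y : 'cV_(rdegree rho)) :
    {in K, forall k, rho k *m y = y} -> exists c, B *m col_mx a y = const_mx c.
  move=> fixy; exists ((B *m col_mx a y) (coset0 G H) 0).
  apply: (transitive_fixed_const KH) => k Kk.
  by rewrite homB ?(subsetP sKG) // fixy.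
have [c Ec] := constB 0 x fixx.
have [d Ed] := constB 1 0 (fun k _ => mulmx0 _ (rho k)).
have : d *: col_mx (0 : 'cV_1) x = c *: col_mx 1 0.
  rewrite -[LHS]mul1mx -[RHS]mul1mx -CB -!mulmxA -!scalemxAr Ec Ed !scalemxAr.
  by congr (_ *m _); apply/colP=> i; rewrite !mxE mulrC.
rewrite !scale_col_mx !scaler0 => /eq_col_mx[_ /eqP].
rewrite scaler_eq0 => /orP[/eqP d0|/eqP//].
have /(congr1 usubmx)/colP : col_mx (1 : 'cV[F]_1) (0 : 'cV_(rdegree rho)) = 0.
  by rewrite -[LHS]mul1mx -CB -mulmxA Ed d0 [const_mx _](_ : _ = 0) ?mulmx0.
by move/(_ 0); rewrite col_mxKu !mxE => /eqP; rewrite oner_eq0.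
Qed.

Lemma augmentation_fixed_neq0 :
  (K * H)%g != G ->
  exists2 x : 'cV[F]_(rdegree rho), x != 0 & {in K, forall k, rho k *m x = x}.
Proof.
move=> KH; have [B [C [BC CB homB]]] := augmentation_mx.
have [f [fixf f_nconst]] := intransitive_fixed_nonconst F sKG sHG KH.
pose a : 'cV_1 := usubmx (C *m f); pose x := dsubmx (C *m f).
have Ef : f = B *m col_mx a x by rewrite vsubmxK mulmxA BC mul1mx.
exists x => [|k Kk].
  (* If x = 0, then f lies in the trivial summand, so all of G fixes it and it is constant. *)
  apply/eqP=> x0.
  have fixG : {in G, forall g, coset_perm_mx F G H g *m f = f}.
    by move=> g Gg; rewrite Ef homB // x0 mulmx0.
  have Ec := transitive_fixed_const (mulGSid sHG) fixG.
  by case/eqP: (f_nconst (f (coset0 G H) 0)).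
have := fixf k Kk; rewrite Ef homB ?(subsetP sKG) //.
move/(congr1 (mulmx C)); rewrite !mulmxA CB !mul1mx.
by case/eq_col_mx.
Qed.

End AugmentationFixedVectors.

Section OrbitLength.

Variables (R : realType) (gT : finGroupType) (G : {group gT}).
Variable rho : representation R[i] G.
Implicit Type x : 'cV[R[i]]_(rdegree rho).

Definition repr_stab x := [set g in G | rho g *m x == x].

Lemma repr_stab_group_set x : group_set (repr_stab x).
Proof.
apply/group_setP; split=> [|g h]; rewrite !inE ?group1 ?repr_mx1 ?mul1mx ?eqxx //.
move=> /andP[Gg /eqP gx] /andP[Gh /eqP hx].
by rewrite groupM // repr_mxM // -mulmxA hx gx eqxx.
Qed.

Canonical repr_stab_group x := Group (repr_stab_group_set x).

Lemma repr_stab_sub x : repr_stab x \subset G.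
Proof. by apply/subsetP=> g; rewrite inE => /andP[]. Qed.

(** Orbit-stabilizer: [phi] sends the coset of g to rho g x, whichever representative is chosen, and
    is injective on cosets of the stabilizer. *)
Lemma card_repr_orbit x : #|` repr_orbit x| = #|G : repr_stab x|%g.
Proof.
pose phi (C : {set gT}) := rho (repr C) *m x.
have phiE g : g \in G -> phi (g *: repr_stab x)%g = rho g *m x.
  move=> Gg; rewrite /phi.
  have /lcosetP[s] := mem_repr g (lcoset_refl (repr_stab_group x) g).
  rewrite inE => /andP[Gs /eqP sx] ->.
  by rewrite repr_mxM // -mulmxA sx.
have -> : repr_orbit x = [fset phi C | C in lcosets (repr_stab x) G]%fset.
  apply/fsetP=> y; apply/imfsetP/imfsetP=> -[/= g].
    move=> Gg ->; exists (g *: repr_stab x)%g; last by rewrite phiE.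
    by apply/lcosetsP; exists g.
  case/lcosetsP=> h Gh -> ->; exists h; rewrite ?phiE //.
rewrite card_in_imfset /=; last first.
  move=> _ _ /lcosetsP[g Gg ->] /lcosetsP[h Gh ->].
  rewrite !phiE // => Egh; apply/(lcoset_eqP (G := repr_stab_group x)).
  rewrite mem_lcoset inE groupM ?groupV //= repr_mxM ?groupV // -mulmxA Egh.
  by rewrite mulmxA -repr_mxM ?groupV // mulVg repr_mx1 mul1mx.
by rewrite -card_lcosets cardE.
Qed.

Lemma unit_sphere_neq0 n (x : 'cV[R[i]]_n) : unit_sphere x -> x != 0.
Proof.
apply: contra_eq_neq => ->; rewrite big1 ?(eq_sym 0) ?oner_eq0 // => i _.
by rewrite mxE normr0 expr0n.
Qed.

Lemma unit_sphere_scale n (x : 'cV[R[i]]_n) :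
  x != 0 -> exists c, unit_sphere (c *: x).
Proof.
move=> x0; pose s := \sum_i `|x i 0| ^+ 2.
have s_gt0 : 0 < s.
  rewrite lt_def sumr_ge0 ?andbT => [|i _]; last by rewrite exprn_ge0.
  apply: contra_neq x0 => /eqP; rewrite psumr_eq0 => [/allP s0|i _]; last first.
    by rewrite exprn_ge0.
  apply/colP=> i; have /eqP/eqP := s0 i (mem_index_enum i).
  by rewrite expf_eq0 /= normr_eq0 mxE => /eqP.
exists (sqrtC s)^-1; rewrite /unit_sphere.
under eq_bigr do rewrite mxE normrM exprMn.
rewrite -mulr_sumr -/s normfV ger0_norm ?sqrtC_ge0 ?ltW // exprVn sqrtCK.
by rewrite mulVf // gt_eqF.
Qed.

(** Normalizing x keeps it fixed by K, so K lies in the stabilizer, whose index divides |G : K|. *)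
Lemma fixed_neq0_orbit (K : {group gT}) x :
  K \subset G -> x != 0 -> {in K, forall k, rho k *m x = x} ->
  exists2 y : 'cV_(rdegree rho),
    unit_sphere y & (#|` repr_orbit y| %| #|G : K|%g)%N.
Proof.
move=> sKG /unit_sphere_scale[c Sy] fixx; exists (c *: x) => //.
rewrite card_repr_orbit; apply: (indexgS G (K := repr_stab_group (c *: x))).
apply/subsetP=> k Kk.
by rewrite inE (subsetP sKG) //= -scalemxAr fixx.
Qed.

End OrbitLength.

Section AlphaAugmentation.

Variables (R : realType) (gT : finGroupType) (G H : {group gT}).
Variable rho : representation R[i] G.
Hypotheses (prHG : H \proper G) (aug : is_augmentation H rho).

(** An empty gcd would be 0. Taking K = 1 shows that rho has a unit vector, as H <> G. *)
Lemma alpha_augmentation_gt0 : (0 < alpha_char rho)%N.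
Proof.
have sHG := proper_sub prHG.
have KH : (1%G * H)%g != G :> {set gT}.
  by rewrite mul1g; apply: contraTneq prHG => ->; rewrite properxx.
have [x x0 fixx] := augmentation_fixed_neq0 aug sHG (sub1G G) KH.
have [y Sy _] := fixed_neq0_orbit (sub1G G) x0 fixx.
have := (dvdn_alpha_char rho _).1 (dvdnn _) y Sy.
by apply: dvdn_gt0; rewrite card_repr_orbit (indexg_gt0 _ (repr_stab_group y)).
Qed.

Lemma prime_dvd_alpha_augmentation p :
  prime p -> (p %| alpha_char rho)%N = p.-nat #|G : H|%g.
Proof.
move=> p_pr; have sHG := proper_sub prHG.
apply/idP/idP=> [p_alpha | pGH].
  have [P sylP] := Sylow_exists p G; have sPG := pHall_sub sylP.
  have [PH | nPH] := eqVneq (P * H)%g (G : {set gT}).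
    (* From |P| |H| = |P H| |P :&: H| with P H = G, the index |G : H| divides |P|. *)
    apply: (pnat_dvd (n := #|P|)); last exact: pHall_pgroup sylP.
    have := mul_cardG P H; rewrite PH -(Lagrange sHG) mulnC -mulnA.
    by move/eqP; rewrite eqn_pmul2l ?cardG_gt0 // => /eqP->; apply: dvdn_mulr.
  have [x x0 fixx] := augmentation_fixed_neq0 aug sHG sPG nPH.
  have [y Sy y_dvd] := fixed_neq0_orbit sPG x0 fixx.
  have p_y := (dvdn_alpha_char rho p).1 p_alpha y Sy.
  have /and3P[_ _] := sylP.
  by rewrite p'natE // (dvdn_trans p_y y_dvd).
apply/dvdn_alpha_char=> x Sx; rewrite card_repr_orbit.
apply: contraT => p'S; case/eqP: (unit_sphere_neq0 Sx).
apply: (augmentation_fixed_eq0 (K := repr_stab_group x) aug (repr_stab_sub x)).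
  apply: (coprime_index_mulG (repr_stab_sub x) sHG).
  by rewrite coprime_sym (pnat_coprime pGH) // p'natE.
by move=> k; rewrite inE => /andP[_ /eqP].
Qed.

End AlphaAugmentation.

Theorem lemma4p4 (R : realType) (gT : finGroupType) (G H : {group gT})
    (rho : representation R[i] G) :
  H \proper G ->
  unitary_repr rho ->
  is_augmentation H rho ->
  ((1 < alpha_char rho)%N <-> prime_power #|G : H|%g) /\
  (prime_power #|G : H|%g ->
   exists p : nat,
     unique (fun q : nat => prime q /\ (q %| #|G : H|%g)%N) p /\
     (p %| alpha_char rho)%N).
Proof.
move=> prHG _ aug; have alpha_gt0 := alpha_augmentation_gt0 prHG aug.
have alphaP := prime_dvd_alpha_augmentation prHG aug.
split; last first.
  case=> p [k [p_pr k_gt0 E]]; exists p.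
  rewrite alphaP // E pnatX pnat_id //; split=> //; split.
    by split=> //; rewrite dvdn_exp.
  by move=> q [q_pr]; rewrite Euclid_dvdX // dvdn_prime2 // => /andP[/eqP].
split=> [alpha_gt1 | [p [k [p_pr _ E]]]].
  have p_pr := pdiv_prime alpha_gt1.
  have /p_natP[k E] : (pdiv (alpha_char rho)).-nat #|G : H|%g.
    by rewrite -alphaP // pdiv_dvd.
  exists (pdiv (alpha_char rho)), k; split=> //.
  (* Exponent 0 would mean |G : H| = 1, against properness. *)
  rewrite lt0n; apply: contraTneq prHG => k0.
  have /eqP := E; rewrite k0 expn0 indexg_eq1 => sGH.
  by rewrite properE sGH andbF.
(* Positivity of alpha turns p | alpha into p <= alpha. *)
apply: leq_trans (prime_gt1 p_pr) (dvdn_leq alpha_gt0 _).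
by rewrite alphaP // E pnatX pnat_id.
Qed.
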